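(* Let $M$ be a compact finite-dimensional manifold and $f\colon M\to M$ a continuous map. The set $\mathcal{O}$ of all observable measures for $f$ is the minimal (with respect to inclusion) weak$^*$ compact subset of $\mathcal{P}$ whose basin of attraction has total Lebesgue measure. That is: $\mathcal{O}$ is weak$^*$ compact, $m(A(\mathcal{O}))=1$, and $\mathcal{O}\subset\mathcal{K}$ for every nonempty weak$^*$ compact set $\mathcal{K}\subset\mathcal{P}$ with $m(A(\mathcal{K}))=1$.
   Context: Let $m$ be a Lebesgue measure on $M$, normalized so that $m(M)=1$; $m$ is not assumed to be $f$-invariant. Let $\mathcal{P}$ be the set of all Borel probability measures on $M$, endowed with the weak$^*$ topology, and fix a metric $\mathrm{dist}$ on $\mathcal{P}$ inducing this topology. For $x\in M$, let $p\omega(x)\subset\mathcal{P}$ be the set of all weak$^*$ limits of convergent subsequences of the sequence $\left\{\frac1n\sum_{j=0}^{n-1}\delta_{f^j(x)}\right\}_{n\ge 1}$, where $\delta_y$ is the Dirac probability measure supported at $y$. For $\mu\in\mathcal{P}$, $\mathrm{dist}(p\omega(x),\mu)$ denotes the distance from the point $\mu$ to the set $p\omega(x)$. A measure $\mu\in\mathcal{P}$ is called observable (or SRB-like) for $f$ if for every $\varepsilon>0$ the set $A_\varepsilon(\mu)=\{x\in M:\ \mathrm{dist}(p\omega(x),\mu)<\varepsilon\}$ has positive Lebesgue measure $m$. The set of all observable measures for $f$ is denoted $\mathcal{O}$. The basin of attraction of a nonempty weak$^*$ compact set $\mathcal{K}\subset\mathcal{P}$ is $A(\mathcal{K})=\{x\in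 M:\ p\omega(x)\subset\mathcal{K}\}$. *)

(* Defs.v *)
From HB Require Import structures.
From mathcomp Require Import all_boot all_order all_algebra.
From mathcomp Require Import all_classical all_reals all_analysis.

Set Implicit Arguments.
Unset Strict Implicit.
Unset Printing Implicit Defensive.

Import Order.TTheory GRing.Theory Num.Theory.
Import numFieldNormedType.Exports.

Local Open Scope classical_set_scope.
Local Open Scope ring_scope.

Definition borel (T : ptopologicalType) := g_sigma_algebraType (@open T).

Definition borel_set (T : ptopologicalType) : set (set T) :=
  (measurable : set (set (borel T))).

(* A library measure is a function on all sets, unconstrained off the
   sigma-algebra, so two distinct values of type [probability] may be the same
   measure. Requiring the value 0 on non-Borel sets makes Leibniz equality
   coincide with equality of measures ([borel_probP]); otherwise no metric could
   induce the weak* topology. *)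
Record borel_prob (R : realType) (M : ptopologicalType) := BorelProb {
  borel_prob_measure :> probability (borel M) R;
  borel_prob_off : forall A, ~ borel_set A -> borel_prob_measure A = 0%E
}.

Lemma probability_funext d (T : measurableType d) (R : realType)
    (mu nu : probability T R) :
  (mu : set T -> \bar R) = (nu : set T -> \bar R) -> mu = nu.
Proof.
case: mu => mu [[p1 p2] [p3] [p4] [p5] [p6] [p7] [p8]].
case: nu => nu [[q1 q2] [q3] [q4] [q5] [q6] [q7] [q8]] /= e; subst nu.
rewrite (Prop_irrelevance q1 p1) (Prop_irrelevance q2 p2).
rewrite (Prop_irrelevance q3 p3) (Prop_irrelevance q4 p4).
rewrite (Prop_irrelevance q5 p5) (Prop_irrelevance q6 p6).
by rewrite (Prop_irrelevance q7 p7) (Prop_irrelevance q8 p8).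
Qed.

Lemma borel_probP (R : realType) (M : ptopologicalType) (mu nu : borel_prob R M) :
  (forall A, borel_set A -> mu A = nu A) <-> mu = nu.
Proof.
split=> [e|-> //].
have /probability_funext : (mu : set _ -> \bar R) = (nu : set _ -> \bar R).
  apply/funext => A; have [mA|nA] := pselect (borel_set A); first exact: e.
  by rewrite (borel_prob_off mu nA) (borel_prob_off nu nA).
case: mu nu {e} => [mu hmu] [nu hnu] /= e; subst nu.
by congr BorelProb; exact: Prop_irrelevance.
Qed.

HB.instance Definition _ (R : realType) (M : ptopologicalType) :=
  gen_eqMixin (borel_prob R M).
HB.instance Definition _ (R : realType) (M : ptopologicalType) :=
  gen_choiceMixin (borel_prob R M).

(* For compact M, the topology below is the weak* topology. *)
Definition pairing (R : realType) (M : ptopologicalType) (mu : borel_prob R M) :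
    {ptws continuousType M R -> R} :=
  fun phi => (\int[mu]_x (phi x : R))%R.

HB.instance Definition _ (R : realType) (M : ptopologicalType) :=
  Topological.copy (borel_prob R M) (initial_topology (@pairing R M)).

Record metrizes (R : realType) (T : topologicalType) (dist : T -> T -> R) : Prop := {
  dist_xx : forall x, dist x x = 0;
  dist_separated : forall x y, dist x y = 0 -> x = y;
  dist_sym : forall x y, dist x y = dist y x;
  dist_triangle : forall y x z, dist x z <= dist x y + dist y z;
  dist_nbhs : forall x (A : set T),
    nbhs x A <-> exists2 e : R, 0 < e & [set y | dist x y < e] `<=` A
}.

Section normalize_off_borel.
Context (R : realType) (M : ptopologicalType).
Variable mu : probability (borel M) R.

Definition off_borel0 (A : set (borel M)) : \bar R :=
  if `[< measurable A >] then mu A else 0%E.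

Let off0 : off_borel0 set0 = 0%E.
Proof. by rewrite /off_borel0 measure0; case: ifP. Qed.

Let off_ge0 A : (0 <= off_borel0 A)%E.
Proof. by rewrite /off_borel0; case: ifP. Qed.

Let offE A : measurable A -> off_borel0 A = mu A.
Proof. by move=> mA; rewrite /off_borel0 asboolT. Qed.

Let off_sigma_additive : semi_sigma_additive off_borel0.
Proof.
move=> F mF tF mUF; rewrite offE//.
under eq_fun do under eq_bigr do rewrite offE//.
exact: measure_semi_sigma_additive.
Qed.

HB.instance Definition _ := isMeasure.Build _ _ _
  off_borel0 off0 off_ge0 off_sigma_additive.

Let offT : off_borel0 setT = 1%E.
Proof. by rewrite offE// probability_setT. Qed.

HB.instance Definition _ := Measure_isProbability.Build _ _ _ off_borel0 offT.

Let off_borel0_off A : ~ borel_set A -> off_borel0 A = 0%E.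
Proof. by move=> nA; rewrite /off_borel0 asboolF. Qed.

Definition borel_prob_of : borel_prob R M := BorelProb off_borel0_off.

End normalize_off_borel.

Section empirical_measures.
Context (R : realType) (M : ptopologicalType).
Variables (f : M -> M) (x : M) (n : nat).

Definition orbit_average : set (borel M) -> \bar R :=
  mscale (n.+1%:R^-1)%:nng (msum (fun j => \d_(iter j f x : borel M)) n.+1).

HB.instance Definition _ := Measure.on orbit_average.

Let orbit_averageT : orbit_average setT = 1%E.
Proof.
have -> : orbit_average setT = (n.+1%:R^-1 * \sum_(k < n.+1) (1 : R))%:E.
  rewrite EFinM -sumEFin; congr (_ * _)%E.
  by apply: eq_bigr => k _; exact: diracT.
by rewrite sumr_const card_ord mulVf// pnatr_eq0.
Qed.

HB.instance Definition _ :=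
  Measure_isProbability.Build _ _ _ orbit_average orbit_averageT.

(* The average of the n+1 Dirac measures at x, f x, ..., f^n x: the sequence
   indexed by the positive integers is shifted by one. *)
Definition empirical : borel_prob R M := borel_prob_of orbit_average.

End empirical_measures.

Section observable_measures.
Context (R : realType) (M : ptopologicalType).
Variables (m : probability (borel M) R) (f : M -> M).

Definition pomega (x : M) : set (borel_prob R M) :=
  [set mu | exists2 s : nat -> nat, increasing_seq s &
              empirical R f x (s k) @[k --> \oo] --> mu].

(* In the extended reals, so that the distance to the empty set is +oo. *)
Definition dist_to (dist : borel_prob R M -> borel_prob R M -> R)
    (K : set (borel_prob R M)) (mu : borel_prob R M) : \bar R :=
  ereal_inf [set (dist nu mu)%:E | nu in K].

(* For M compact metrizable and f continuous the empirical measures depend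
   continuously on x, so the set measured here is Borel; so is the basin below of
   a compact set. *)
Definition observable (dist : borel_prob R M -> borel_prob R M -> R) :
    set (borel_prob R M) :=
  [set mu | forall e : R, 0 < e ->
     (0 < m [set x | (dist_to dist (pomega x) mu < e%:E)%E])%E].

Definition basin (K : set (borel_prob R M)) : set M :=
  [set x | pomega x `<=` K].

End observable_measures.

Record chart (R : realType) (M : topologicalType) (n : nat) := Chart {
  chart_dom : set M;
  chart_map : M -> 'rV[R]_n;
  chart_inv : 'rV[R]_n -> M;
  chart_dom_open : open chart_dom;
  chart_im_open : open (chart_map @` chart_dom);
  chart_mapK : {in chart_dom, cancel chart_map chart_inv};
  chart_map_continuous : {in chart_dom, continuous chart_map};
  chart_inv_continuous : {in chart_map @` chart_dom, continuous chart_inv}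
}.

Definition chart_im (R : realType) (M : topologicalType) (n : nat)
  (c : chart R M n) : set 'rV[R]_n := chart_map c @` chart_dom c.

(* To be used with U open. *)
Definition C1_on (R : realType) (n : nat) (U : set 'rV[R]_n)
    (g : 'rV[R]_n -> 'rV[R]_n) :=
  forall y, U y -> differentiable g y /\
    forall v, {for y, continuous (fun z => 'D_v g z)}.

Record C1_atlas (R : realType) (M : topologicalType) (n : nat)
    (atlas : set (chart R M n)) : Prop := {
  atlas_cover : forall x, exists2 c, atlas c & chart_dom c x;
  atlas_C1 : forall c c', atlas c -> atlas c' ->
    C1_on (chart_map c @` (chart_dom c `&` chart_dom c'))
          (chart_map c' \o chart_inv c)
}.

Definition is_lebesgue (R : realType) (n : nat)
    (lam : {measure set (borel 'rV[R]_n) -> \bar R}) : Prop :=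
  forall a b : 'rV[R]_n, (forall i, a 0 i <= b 0 i) ->
    lam [set y | forall i, a 0 i <= y 0 i <= b 0 i] =
      (\prod_(i < n) (b 0 i - a 0 i))%:E.

(* m is a volume: in each chart it has a positive continuous density with respect
   to the Lebesgue measure of R^n (e.g. the normalized Riemannian volume). *)
Definition lebesgue_on_manifold (R : realType) (M : ptopologicalType) (n : nat)
    (atlas : set (chart R M n)) (m : probability (borel M) R) : Prop :=
  exists2 lam : {measure set (borel 'rV[R]_n) -> \bar R}, is_lebesgue lam &
  forall c, atlas c -> exists rho : 'rV[R]_n -> R,
    [/\ {in chart_im c, continuous rho},
        forall y, chart_im c y -> 0 < rho y &
        forall A, borel_set A -> A `<=` chart_dom c ->
          m A = (\int[lam]_(y in chart_map c @` A) (rho y)%:E)%E].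

(* Main.v *)
From HB Require Import structures.
Require Import Defs.
From mathcomp Require Import all_boot all_order all_algebra.
From mathcomp Require Import all_classical all_reals all_analysis measurable_realfun.
From mathcomp Require Import finmap lra.
Import numFieldNormedType.Exports.

Set Implicit Arguments.
Unset Strict Implicit.
Unset Printing Implicit Defensive.

Import Order.TTheory GRing.Theory Num.Theory.

Local Open Scope classical_set_scope.
Local Open Scope ring_scope.

(** Write P for the space of Borel probability measures on M, p(x) for the set of
    limit measures of the orbit of x, and O for the set of observable measures.

    P is weak* compact ([compact_borel_prob]), and everything else follows from
    this and from the continuity of the empirical measures in x.  Compactness rests
    on the Riesz theorem ([riesz_representation]): the limits of the integrals
    along an ultrafilter of measures form a positive functional L on C(M) with
    L 1 = 1, and such a functional is the integral for a probability measure.  The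
    measure of an open set V is defined as the supremum of L f over the continuous
    f between 0 and the indicator of V; the outer measure deduced from it makes
    open sets Caratheodory measurable, and slicing f into thin horizontal layers
    identifies L f with the integral of f.

    For a measure mu and e > 0, let A(mu, e) be the set of points x such that p(x)
    meets the ball of centre mu and radius e.  It is a Borel set
    ([borel_pomega_near]), because compactness of P lets one express it by the
    infinitely many visits of the empirical measures of x to slightly smaller
    balls.  The measure mu is observable when all the sets A(mu, e) have positive
    measure.

    O is closed, since A(nu, e / 2) is contained in A(mu, e) when nu is
    (e / 2)-close to mu; hence O is compact.

    The complement of O is covered by countably many balls whose sets A(mu, e) are
    negligible ([open_countable_cover]), and a point outside these countably many
    sets has all its limit measures in O ([closed_basinE]).  So the basin of O has
    full measure.

    Lastly, if K is compact and mu is an observable measure outside K, then a ball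
    around mu avoids K, and the corresponding A(mu, e), of positive measure, is
    disjoint from the basin of K.  So a K whose basin has full measure contains
    O. *)

(** * Truncations of a real function *)

Section truncation.
Context {R : realType} {M : topologicalType}.
Implicit Types (f g : M -> R) (s t e : R).

(** The positive part of [f - t].  A nonnegative [f] is the sum of the layers
    [cut t f - cut (t + e) f] over the multiples [t] of [e]; a layer vanishes
    where [f <= t] and equals [e] where [t + e <= f]. *)
Definition cut t f : M -> R := fun x => Num.max (f x - t) 0.

Lemma cut_ge0 t f x : 0 <= cut t f x.
Proof. by rewrite le_max lexx orbT. Qed.

Lemma cut_ge t f x : t <= f x -> cut t f x = f x - t.
Proof. by move=> tf; rewrite /cut max_l// subr_ge0. Qed.

Lemma cut_le t f x : f x <= t -> cut t f x = 0.
Proof. by move=> tf; rewrite /cut max_r// subr_le0. Qed.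

Lemma cut0 f : (forall x, 0 <= f x) -> cut 0 f = f.
Proof. by move=> f0; apply/funext => x; rewrite cut_ge// subr0. Qed.

Lemma le_cut t f x : f x <= cut t f x + t.
Proof. by rewrite -lerBlDr le_max lexx. Qed.

Lemma cut_step s t f x : s <= t -> 0 <= cut s f x - cut t f x <= t - s.
Proof.
move=> st; case: (leP (f x) t) => ft.
  rewrite [cut t f x]cut_le// subr0 cut_ge0/= /cut ge_max.
  by apply/andP; split; lra.
have sf : s < f x by exact: le_lt_trans ft.
by rewrite !cut_ge ?(ltW ft) ?(ltW sf)//; lra.
Qed.

Lemma continuous_cut t f : continuous f -> continuous (cut t f).
Proof.
move=> cf x; apply: (@continuous_max R M (fun y => f y - t) (fun=> 0)).
  by apply: cvgB; [exact: cf|exact: cvg_cst].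
exact: cvg_cst.
Qed.

Lemma closed_ge f t : continuous f -> closed [set x | t <= f x].
Proof.
move=> cf; have -> : [set x | t <= f x] = f @^-1` [set` `[t, +oo[].
  by apply/seteqP; split => x /=; rewrite in_itv/= andbT.
by apply: closed_comp => [x _|]; [exact: cf|exact: interval_closed].
Qed.

Lemma open_gt f t : continuous f -> open [set x | t < f x].
Proof.
move=> cf; have -> : [set x | t < f x] = f @^-1` [set` `]t, +oo[].
  by apply/seteqP; split => x /=; rewrite in_itv/= andbT.
by apply: open_comp => [x _|]; [exact: cf|exact: interval_open].
Qed.

End truncation.

(** * Normalized positive functionals *)

(** The states of C(M), taken on all functions and constrained on the continuous
    ones only, so that a continuity proof never has to be carried by an argument
    of [L]. *)
Record normalized_positive (R : realType) (M : topologicalType)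
    (L : (M -> R) -> R) : Prop := {
  npD : forall f g : M -> R, continuous f -> continuous g ->
    L (fun x => f x + g x) = L f + L g;
  npZ : forall (c : R) (f : M -> R), continuous f -> L (fun x => c * f x) = c * L f;
  np_ge0 : forall f : M -> R, continuous f -> (forall x, 0 <= f x) -> 0 <= L f;
  np1 : L (fun=> 1) = 1
}.

Section normalized_positive_theory.
Context {R : realType} {M : topologicalType}.
Variables (L : (M -> R) -> R).
Hypothesis HL : normalized_positive L.
Implicit Types (f g : M -> R).

Lemma np_cst c : L (fun=> c) = c.
Proof.
have -> : (fun=> c) = (fun x : M => c * (fun=> 1) x).
  by apply/funext => x; rewrite mulr1.
by rewrite npZ ?np1 ?mulr1// => x; exact: cvg_cst.
Qed.

Lemma npB f g : continuous f -> continuous g ->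
  L (fun x => f x - g x) = L f - L g.
Proof.
move=> cf cg.
have -> : (fun x => f x - g x) = (fun x => f x + (fun y => -1 * g y) x).
  by apply/funext => x; rewrite mulN1r.
rewrite npD// ?npZ ?mulN1r// => x; apply: cvgM; [exact: cvg_cst|exact: cg].
Qed.

Lemma le_np f g : continuous f -> continuous g -> (forall x, f x <= g x) ->
  L f <= L g.
Proof.
move=> cf cg fg; rewrite -subr_ge0 -npB//; apply: np_ge0 => // [x|x].
  by apply: cvgB; [exact: cg|exact: cf].
by rewrite subr_ge0.
Qed.

(** The price of a truncation: replacing [f] by [cut t f], whose support lies in
    the closed set where [t <= f], costs at most [t]. *)
Lemma np_cut t f : continuous f -> L f <= L (cut t f) + t.
Proof.
move=> cf; have cc : continuous (cut t f) by exact: continuous_cut.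
rewrite -[X in _ + X]np_cst -npD//; last by move=> x; exact: cvg_cst.
apply: le_np => // [x|x]; last exact: le_cut.
by apply: cvgD; [exact: cc|exact: cvg_cst].
Qed.

End normalized_positive_theory.

(** * Integrals of continuous functions on a compact space *)

Section integral_of_continuous.
Context {R : realType} {M : ptopologicalType}.
Hypothesis cM : compact [set: M].
Implicit Types (f : M -> R) (mu : probability (borel M) R).

Lemma borel_set_open (A : set M) : open A -> borel_set A.
Proof. exact: sub_sigma_algebra. Qed.

Lemma continuous_borel_measurable f :
  continuous f -> measurable_fun [set: borel M] (f : borel M -> R).
Proof.
move=> /continuousP cf; apply: (measurability _ (RGenOpens.measurableE R)).
move=> _ [_ [a [b ->] <-]]; rewrite setTI; apply: borel_set_open.
by apply: cf; exact: interval_open.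
Qed.

Lemma continuous_bounded f : continuous f -> exists2 B, 0 < B & forall x, `|f x| <= B.
Proof.
move=> cf; have /compact_bounded[B [_ hB]] : compact (f @` setT).
  by apply: continuous_compact => //; exact: continuous_subspaceT.
exists (`|B| + 1) => [|x]; first by rewrite ltr_wpDl.
by apply: (hB (`|B| + 1)) => //; rewrite (le_lt_trans (ler_norm B))// ltrDl.
Qed.

Lemma continuous_integrable mu f :
  continuous f -> mu.-integrable setT (EFin \o (f : borel M -> R)).
Proof.
move=> cf; apply: measurable_bounded_integrable => //.
- by rewrite (le_lt_trans (probability_le1 mu _)) ?ltry.
- exact: continuous_borel_measurable.
- have [B _ hB] := continuous_bounded cf.
  by exists B; split; rewrite ?num_real// => C BC x _ /=; rewrite (le_trans (hB x))// ltW.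
Qed.

Lemma Rintegral_np mu : normalized_positive (fun f => \int[mu]_x (f x : R))%R.
Proof.
split=> [f g cf cg|c f cf|f _ f0|].
- by rewrite RintegralD//; exact: continuous_integrable.
- by rewrite RintegralZl//; exact: continuous_integrable.
- by apply: Rintegral_ge0 => x _; exact: f0.
- by rewrite Rintegral_cst// mul1r; exact: (congr1 fine (probability_setT mu)).
Qed.

(** The layer of height [e] just below the level [t] already equals [e] on the
    set where [t < f]. *)
Lemma Rintegral_layer mu f t e : continuous f -> 0 <= e ->
  e * fine (mu [set x | t < f x]%R) <=
  \int[mu]_x (cut (t - e) f x) - \int[mu]_x (cut t f x).
Proof.
move=> cf e0; have cc s : continuous (cut s f) by exact: continuous_cut.
pose A : set (borel M) := [set x | t < f x].
have mA : measurable A by apply: borel_set_open; exact: open_gt.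
have iA : mu.-integrable setT (EFin \o (\1_A : borel M -> R)).
  apply: measurable_bounded_integrable => //.
    by rewrite (le_lt_trans (probability_le1 mu _)) ?ltry.
  exists 1; split; rewrite ?num_real// => C C1 x _ /=.
  by rewrite indicE ger0_norm// (le_trans _ (ltW C1))//; case: (_ \in _).
rewrite -(npB (Rintegral_np mu))//.
have -> : fine (mu A) = (\int[mu]_x (\1_A x : R))%R.
  by rewrite /Rintegral integral_indic// setIT.
rewrite -RintegralZl//; apply: le_Rintegral => //.
- rewrite [X in _.-integrable _ X](_ : _ =
    (fun x => e%:E * (EFin \o (\1_A : borel M -> R)) x)%E)//.
  exact: integrableZl.
- by apply: continuous_integrable => x; apply: cvgB; exact: cc.
- move=> x _; rewrite indicE; have [|] := boolP (x \in A); last first.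
    have te : t - e <= t by lra.
    by rewrite mulr0 => _; have /andP[] := cut_step f x te.
  by move=> /set_mem; rewrite /A/= => tx; rewrite !cut_ge//; lra.
Qed.

End integral_of_continuous.

(** * The Riesz representation theorem *)

Section content_of_open_sets.
Context {R : realType} {M : ptopologicalType}.
Hypotheses (cM : compact [set: M]) (hM : hausdorff_space M).
Variables (L : (M -> R) -> R).
Hypothesis HL : normalized_positive L.
Implicit Types (f g : M -> R) (V W : set M).

(** Continuous minorants of the indicator of [V].  Such an [f] only has to vanish
    off [V]: where room is needed around its support, [cut e f] is used instead,
    at the price given by [np_cut]. *)
Record below V f : Prop := {
  below_cont : continuous f;
  below_ge0 : forall x, 0 <= f x;
  below_le1 : forall x, f x <= 1;
  below_off : forall x, ~ V x -> f x = 0 }.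

Definition open_content V : \bar R :=
  ereal_sup [set (L f)%:E | f in below V].
Local Notation lam := open_content.

Lemma below0 V : below V (fun=> 0).
Proof. by split=> // x; exact: cvg_cst. Qed.

Lemma sub_below V W f : V `<=` W -> below V f -> below W f.
Proof.
by move=> VW [fc f0 f1 fV]; split=> // x Wx; apply: fV => /VW.
Qed.

Lemma below_cut V W f e : 0 < e -> below V f ->
  [set x | e <= f x] `<=` W -> below W (cut e f).
Proof.
move=> e0 [fc f0 f1 fV] eW; split => [||x|x Wx].
- exact: continuous_cut.
- exact: cut_ge0.
- by rewrite ge_max ler01 andbT; have := f1 x; lra.
- by rewrite cut_le// leNgt; apply/negP => /ltW /eW.
Qed.

Lemma open_content_le V (c : \bar R) :
  (forall f, below V f -> (L f)%:E <= c)%E -> (lam V <= c)%E.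
Proof. by move=> h; apply: ge_ereal_sup => _ [f Vf <-]; exact: h. Qed.

Lemma open_content_ge V f : below V f -> ((L f)%:E <= lam V)%E.
Proof. by move=> Vf; apply: ereal_sup_ubound; exists f. Qed.

Lemma open_content_ge0 V : (0 <= lam V)%E.
Proof.
by have := open_content_ge (below0 V); rewrite np_cst.
Qed.

Lemma open_content_le1 V : (lam V <= 1)%E.
Proof.
apply: open_content_le => f [fc f0 f1 fV]; rewrite lee_fin -(np_cst HL 1).
by apply: le_np => // x; exact: cvg_cst.
Qed.

Lemma le_open_content V W : V `<=` W -> (lam V <= lam W)%E.
Proof.
by move=> VW; apply: open_content_le => f /(sub_below VW)/open_content_ge.
Qed.

Lemma open_content0 : lam set0 = 0%E.
Proof.
apply/eqP; rewrite eq_le open_content_ge0 andbT.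
apply: open_content_le => f [_ _ _ f0].
have -> : f = (fun=> 0) by apply/funext => x; exact: f0.
by rewrite np_cst.
Qed.

Lemma open_contentT : lam setT = 1%E.
Proof.
apply/eqP; rewrite eq_le open_content_le1/= -[X in (X%:E <= _)%E](np_cst HL 1).
by apply: open_content_ge; split=> // [x|x []//]; exact: cvg_cst.
Qed.

Lemma open_content_cut V W f e : 0 < e -> below V f ->
  [set x | e <= f x] `<=` W -> ((L f)%:E <= lam W + e%:E)%E.
Proof.
move=> e0 Vf eW; apply: (@le_trans _ _ (L (cut e f) + e)%:E).
  by rewrite lee_fin; apply: np_cut => //; exact: below_cont Vf.
by rewrite EFinD leeD2r//; apply: open_content_ge; exact: below_cut Vf eW.
Qed.

(** After truncation, [f] lives on the closed set [f >= e], which is covered by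
    [V] and [W].  A Urysohn function equal to 1 on the part outside [W] and to 0
    outside [V] splits it into a piece below [V] and a piece below [W]. *)
Lemma open_contentU V W : open V -> open W ->
  (lam (V `|` W) <= lam V + lam W)%E.
Proof.
move=> oV oW; apply: open_content_le => f fVW.
apply/lee_addgt0Pr => e e0.
have [fc f0 f1 f_off] := fVW.
pose F := cut e f.
have [Fc F0 F1 F_off] : below (V `|` W) F.
  apply: (below_cut e0 fVW) => x /= ef; apply: contrapT => /f_off fx.
  by move: ef; rewrite fx leNgt e0.
pose K := [set x | e <= f x] `\` W.
have cK : closed K by apply: closedI; [exact: closed_ge|exact: open_closedC].
have KV : (~` V) `&` K = set0.
  apply/seteqP; split => // x [Vx [/= ef Wx]].
  by move: ef; rewrite f_off ?leNgt ?e0// => -[].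
have [g [gc g01 gV gK]] := (uniform_separatorP (R := R) _ _).1
  (normal_uniform_separator (compact_normal hM cM) (open_closedC oV) cK KV).
have g0 x : 0 <= g x.
  by have /= := g01 (g x) (ex_intro2 _ _ x I erefl); rewrite in_itv/= => /andP[].
have {}gV x : ~ V x -> g x = 0 by move=> Vx; apply: gV; exists x.
have {}gK x : K x -> g x = 1 by move=> Kx; apply: gK; exists x.
pose G x := Num.min (F x) (g x).
have Gc : continuous G by move=> x; apply: continuous_min; [exact: Fc|exact: gc].
have VG : below V G.
  split=> // x; first by rewrite le_min F0 g0.
    by rewrite ge_min F1.
  by move=> /gV gx; rewrite /G gx min_r.
have WFG : below W (fun x => F x - G x).
  split=> [x|x|x|x Wx].
  - by apply: cvgB; [exact: Fc|exact: Gc].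
  - by rewrite subr_ge0 ge_min lexx.
  - by rewrite lerBlDr -[leLHS]addr0 lerD// le_min F0 g0.
  - have [fx|fx] := leP e (f x).
      by rewrite /G (gK x)// min_l ?F1// subrr.
    by rewrite /G /F cut_le ?(ltW fx)// min_l ?g0// subrr.
apply: (@le_trans _ _ (L F + e)%:E); first by rewrite lee_fin; exact: np_cut.
rewrite EFinD leeD2r// (_ : L F = L G + L (fun x => F x - G x)).
  by rewrite EFinD leeD//; exact: open_content_ge.
by rewrite npB// addrC subrK.
Qed.

Lemma open_content_bigsetU (V : nat -> set M) n : (forall i, open (V i)) ->
  (lam (\big[setU/set0]_(i < n) V i) <= \sum_(i < n) lam (V i))%E.
Proof.
move=> oV; elim: n => [|n ih]; first by rewrite !big_ord0 open_content0.
rewrite !big_ord_recr/=; apply: le_trans (leeD2r _ ih).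
by apply: open_contentU => //; rewrite -bigcup_mkord; exact: bigcup_open.
Qed.

(** The closed set where a minorant is at least [e] is compact, so that finitely
    many [V i] cover it: countable subadditivity reduces to the finite one. *)
Lemma open_content_bigcup (V : nat -> set M) : (forall i, open (V i)) ->
  (lam (\bigcup_i V i) <= \sum_(i <oo) lam (V i))%E.
Proof.
move=> oV; apply: open_content_le => f fV; apply/lee_addgt0Pr => e e0.
have [n eV] : exists n, [set x | e <= f x] `<=` \big[setU/set0]_(i < n) V i.
  have cK : compact [set x | e <= f x].
    by apply: subclosed_compact cM _ => //; exact: closed_ge (below_cont fV).
  move: cK; rewrite compact_cover => /(_ nat setT V (fun i _ => oV i)) [].
    move=> x /= ex; apply: contrapT => /(below_off fV) fx.
    by move: ex; rewrite fx leNgt e0.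
  move=> D _ DV; exists (\max_(i <- D) i).+1 => x /DV [i/= Di Vix].
  rewrite -bigcup_mkord; exists i => //=; rewrite ltnS.
  exact: (@leq_bigmax_seq _ _ xpredT (fun j => j) i Di).
apply: le_trans (open_content_cut e0 fV eV) _; rewrite leeD2r//.
apply: le_trans (open_content_bigsetU n oV) _.
rewrite -(big_mkord xpredT (fun i => lam (V i))).
by apply: nneseries_lim_ge => // i _ _; exact: open_content_ge0.
Qed.

Definition outer_content (E : set M) : \bar R :=
  ereal_inf [set lam V | V in [set V | open V /\ E `<=` V]].
Local Notation outer := outer_content.

Lemma outer_content_le E V : open V -> E `<=` V -> (outer E <= lam V)%E.
Proof. by move=> oV EV; apply: ereal_inf_lbound; exists V. Qed.

Lemma outer_content_ge E (c : \bar R) :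
  (forall V, open V -> E `<=` V -> c <= lam V)%E -> (c <= outer E)%E.
Proof. by move=> h; apply: le_ereal_inf_tmp => _ [V [oV EV] <-]; exact: h. Qed.

Lemma outer_content_open V : open V -> outer V = lam V.
Proof.
move=> oV; apply/eqP; rewrite eq_le outer_content_le//=.
by apply: outer_content_ge => W _; exact: le_open_content.
Qed.

Let outer0 : outer set0 = 0%E.
Proof. by rewrite outer_content_open ?open_content0//; exact: open0. Qed.

Let outer_ge0 E : (0 <= outer E)%E.
Proof. by apply: outer_content_ge => *; exact: open_content_ge0. Qed.

Let le_outer : {homo outer : A B / A `<=` B >-> (A <= B)%E}.
Proof.
move=> A B AB; apply: outer_content_ge => V oV BV.
exact/outer_content_le/(subset_trans AB).
Qed.

Lemma outer_content_fin E : outer E \is a fin_num.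
Proof.
rewrite ge0_fin_numE// (@le_lt_trans _ _ 1%E) ?ltry//.
by rewrite -open_contentT; apply: outer_content_le => //; exact: openT.
Qed.

Let outer_sigma_subadditive : sigma_subadditive outer.
Proof.
move=> E; apply/lee_addgt0Pr => e e0.
apply: le_trans (epsilon_trick _ _ (ltW e0)); last by move=> n; exact: outer_ge0.
have /choice[V HV] n : exists V, [/\ open V, E n `<=` V &
    (lam V <= outer (E n) + (e / (2 ^ n.+1)%:R)%:E)%E].
  have en : 0 < e / (2 ^ n.+1)%:R by rewrite divr_gt0// ltr0n expn_gt0.
  have [_ [V [oV EV] <-] /ltW] := lb_ereal_inf_adherent en (outer_content_fin (E n)).
  by exists V.
apply: (@le_trans _ _ (lam (\bigcup_n V n))).
  apply: outer_content_le; first by apply: bigcup_open => i _; have [] := HV i.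
  by move=> x [i _ Eix]; exists i => //; have [_ + _] := HV i; exact.
apply: le_trans.
  by apply: open_content_bigcup => i; have [] := HV i.
apply: lee_nneseries => [i _ _|i _]; first exact: open_content_ge0.
by have [] := HV i.
Qed.

HB.instance Definition _ := isOuterMeasure.Build R M outer
  outer0 outer_ge0 le_outer outer_sigma_subadditive.

(** A minorant [f] of [W `&` A] that almost realizes its content is truncated to
    [cut e f], supported in the closed set [C] where [e <= f].  The open set
    [W `\` C] still contains [X `\` A], and a minorant [g] of it can be added to
    [cut e f] without exceeding 1 nor leaving [W]. *)
Lemma open_caratheodory A : open A -> outer.-caratheodory A.
Proof.
move=> oA; apply: le_caratheodory_measurable => X.
apply: outer_content_ge => W oW XW.
have oWA : open (W `&` A) by exact: openI.
apply: (@le_trans _ _ (lam (W `&` A) + outer (X `&` ~` A))%E).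
  by apply: leeD2r; apply: outer_content_le => //; exact: setSI.
rewrite -leeBrDr ?outer_content_fin//; apply: open_content_le => f fWA.
rewrite leeBrDr ?outer_content_fin//; apply/lee_addgt0Pr => e e0.
pose C := [set x | e <= f x].
have oWC : open (W `\` C).
  by apply: openI => //; rewrite openC; exact: closed_ge (below_cont fWA).
apply: (@le_trans _ _ ((L f)%:E + lam (W `\` C))%E).
  apply: leeD2l; apply: outer_content_le => // x [Xx Ax]; split; first exact: XW.
  by rewrite /C /= (below_off fWA) ?leNgt ?e0// => -[].
rewrite addeC -leeBrDr//; apply: open_content_le => g gWC.
rewrite leeBrDr//; apply: (@le_trans _ _ (L g + (L (cut e f) + e))%:E).
  by rewrite -EFinD lee_fin lerD2l; exact: np_cut (below_cont fWA).
rewrite addrA EFinD leeD2r// -npD//; first apply: open_content_ge.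
- have [gc g0 g1 g_off] := gWC; have [fc f0 f1 f_off] := fWA.
  split=> [x|x|x|x Wx].
  + by apply: cvgD; [exact: gc|exact: continuous_cut].
  + by rewrite addr_ge0// cut_ge0.
  + have [fx|fx] := leP e (f x).
      by rewrite g_off ?add0r; [rewrite cut_ge//; have := f1 x; lra|case].
    by rewrite cut_le ?(ltW fx)// addr0.
  + by rewrite g_off ?f_off ?cut_le ?f_off ?addr0// ?(ltW e0)//; case.
- exact: below_cont gWC.
- by apply: continuous_cut; exact: below_cont fWA.
Qed.

Lemma borel_caratheodory A : borel_set A -> outer.-caratheodory A.
Proof.
suff sub : <<s @open M >> `<=` outer.-caratheodory by move=> /sub.
apply: smallest_sub; last exact: open_caratheodory.
split; first exact: caratheodory_measurable_set0.
  by move=> B mB; rewrite setTD; exact: caratheodory_measurable_setC.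
exact: caratheodory_measurable_bigcup.
Qed.

(** The outer measure again, on the Borel type: a new constant, because this is the
    one that carries the structure of a probability measure. *)
Definition content_measure : set (borel M) -> \bar R := outer.

Let content_measure_sigma_additive : semi_sigma_additive content_measure.
Proof.
move=> F mF tF mUF.
apply: (@caratheodory_measure_sigma_additive R M outer) => //.
  by move=> i; exact: (borel_caratheodory (mF i)).
exact: (borel_caratheodory mUF).
Qed.

HB.instance Definition _ := isMeasure.Build _ (borel M) R content_measure
  outer0 outer_ge0 content_measure_sigma_additive.

Let content_measureT : content_measure setT = 1%E.
Proof. by rewrite /content_measure outer_content_open ?open_contentT//; exact: openT. Qed.

HB.instance Definition _ :=
  Measure_isProbability.Build _ (borel M) R content_measure content_measureT.

Lemma ge_content_measure V f : open V -> below V f -> ((L f)%:E <= content_measure V)%E.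
Proof. by move=> oV fV; rewrite /content_measure outer_content_open// open_content_ge. Qed.

(** A layer divided by its height [e] is a minorant of the indicator of [t < f]. *)
Lemma content_measure_layer f t e : continuous f -> 0 < e ->
  L (cut t f) - L (cut (t + e) f) <=
  e * fine (content_measure [set x | t < f x]%R).
Proof.
move=> cf e0; have cc s : continuous (cut s f) by exact: continuous_cut.
have oV : open [set x | t < f x] by exact: open_gt.
have st x : 0 <= cut t f x - cut (t + e) f x <= e.
  have te : t <= t + e by lra.
  by have := cut_step f x te; rewrite [t + e - t]addrAC subrr add0r.
have cB : continuous (fun x => cut t f x - cut (t + e) f x).
  by move=> x; apply: cvgB; exact: cc.
have bV : below [set x | t < f x] (fun x => e^-1 * (cut t f x - cut (t + e) f x)).
  split=> [x|x|x|x /= /negP].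
  - by apply: cvgM; [exact: cvg_cst|exact: cB].
  - by rewrite mulr_ge0 ?invr_ge0 ?(ltW e0)//; have /andP[] := st x.
  - by rewrite mulrC ler_pdivrMr// mul1r; have /andP[] := st x.
  - by rewrite -leNgt => fx; rewrite !cut_le ?subrr ?mulr0//; lra.
have := ge_content_measure oV bV; rewrite npZ// npB//.
rewrite -[in leRHS](@fineK _ (content_measure _)) ?outer_content_fin//.
by rewrite lee_fin mulrC ler_pdivrMr// [leRHS]mulrC.
Qed.

(** [content_measure_layer] at the level [t] and [Rintegral_layer] at the same level
    bound a layer of [L f] by the preceding layer of the integral of [f].  Summing
    over the levels [i * e] telescopes, and the shift by one layer costs [e]. *)
Let le_np_integral f : continuous f -> (forall x, 0 <= f x <= 1) ->
  L f <= \int[content_measure]_x (f x).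
Proof.
move=> cf f01; set I := fun g : M -> R => (\int[content_measure]_x (g x))%R.
have HI : normalized_positive I by exact: (Rintegral_np cM).
apply/ler_addgt0Pr => e e0.
have [n ne] : exists n : nat, 1 <= n%:R * e.
  exists (Num.truncn e^-1).+1; rewrite -ler_pdivrMr// div1r ltW//.
  by rewrite truncnS_gt.
pose t (i : nat) : R := i%:R * e.
have tS i : t i.+1 = t i + e by rewrite /t -natr1 mulrDl mul1r.
have step i : L (cut (t i.+1) f) - L (cut (t i.+2) f) <=
    I (cut (t i) f) - I (cut (t i.+1) f).
  apply: (@le_trans _ _ (e * fine (content_measure [set x | t i.+1 < f x]%R))).
    by rewrite [t i.+2]tS; exact: content_measure_layer.
  have ti : t i.+1 - e = t i by rewrite tS addrK.
  by have := Rintegral_layer cM content_measure (t i.+1) cf (ltW e0); rewrite ti.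
have cut0f i : (n <= i)%N -> cut (t i) f = fun=> 0.
  move=> ni; apply/funext => x; apply: cut_le.
  have /andP[_ f1] := f01 x; apply: (le_trans f1 (le_trans ne _)).
  by rewrite /t ler_pM2r// ler_nat.
have : \sum_(0 <= i < n) (L (cut (t i.+1) f) - L (cut (t i.+2) f)) <=
       \sum_(0 <= i < n) (I (cut (t i) f) - I (cut (t i.+1) f)).
  by apply: ler_sum => i _; exact: step.
have tel (u : nat -> R) : \sum_(0 <= i < n) (u i - u i.+1) = u 0%N - u n.
  under eq_bigr do rewrite -opprB.
  by rewrite sumrN telescope_sumr// opprB.
rewrite (tel (fun i => L (cut (t i.+1) f))) (tel (fun i => I (cut (t i) f))).
rewrite (cut0f n)// (cut0f n.+1)// (np_cst HL) (np_cst HI) !subr0 => h.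
apply: (le_trans (np_cut HL e cf)); rewrite lerD2r.
move: h; rewrite /t mul1r mul0r => /le_trans; apply.
by rewrite cut0// => x; have /andP[] := f01 x.
Qed.

(** The reverse inequality is the previous one for [1 - f]. *)
Let np_eq_integral01 f : continuous f -> (forall x, 0 <= f x <= 1) ->
  L f = \int[content_measure]_x (f x).
Proof.
move=> cf f01; set I := fun g : M -> R => (\int[content_measure]_x (g x))%R.
have HI : normalized_positive I by exact: (Rintegral_np cM).
apply/eqP; rewrite eq_le le_np_integral//=.
have c1 : continuous (fun _ : M => 1 : R) by move=> x; exact: cvg_cst.
(* this shift turns the inequality into that of [le_np_integral] for [1 - f] *)
rewrite -(lerD2r (- L f - I f + 1)).
have -> : I f + (- L f - I f + 1) = L (fun=> 1) - L f by rewrite np_cst//; lra.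
have -> : L f + (- L f - I f + 1) = I (fun=> 1) - I f by rewrite np_cst//; lra.
rewrite -!npB//; apply: le_np_integral => [x|x]; first by apply: cvgB; [exact: c1|exact: cf].
by have /andP[? ?] := f01 x; apply/andP; split; lra.
Qed.

(** An affine change of values brings a bounded function into [0, 1]. *)
Let np_eq_integral f : continuous f -> L f = \int[content_measure]_x (f x).
Proof.
move=> cf; set I := fun g : M -> R => (\int[content_measure]_x (g x))%R.
have HI : normalized_positive I by exact: (Rintegral_np cM).
have [B B0 fB] := continuous_bounded cM cf.
pose g x := (2 * B)^-1 * (f x + B).
have cc : continuous (fun _ : M => B) by move=> x; exact: cvg_cst.
have cfB : continuous (fun x => f x + B).
  by move=> x; apply: cvgD; [exact: cf|exact: cc].
have cg : continuous g by move=> x; apply: cvgM; [exact: cvg_cst|exact: cfB].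
have B2 : 0 < 2 * B by lra.
have : L g = I g.
  apply: np_eq_integral01 => // x; have := fB x; rewrite ler_norml => /andP[? ?].
  rewrite /g; apply/andP; split.
    by apply: mulr_ge0; rewrite ?invr_ge0 ?(ltW B2)//; lra.
  by rewrite mulrC ler_pdivrMr// mul1r; lra.
rewrite /g !npZ// !npD// !np_cst// => /mulfI/addIr; apply.
by rewrite invr_neq0// gt_eqF.
Qed.

(** The representing measure is the Caratheodory extension of the content of open
    sets. *)
Theorem riesz_representation : exists mu : probability (borel M) R,
  forall f, continuous f -> \int[mu]_x (f x) = L f.
Proof. by exists content_measure => f /np_eq_integral. Qed.

End content_of_open_sets.

(** * Weak* compactness of the space of probability measures *)

Lemma ultra_bounded_cvg (R : realType) (T : Type) (F : set_system T) (g : T -> R) (B : R) :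
  UltraFilter F -> (forall x, `|g x| <= B) -> cvg (g @ F).
Proof.
move=> FU gB; have gBF : (g @ F) [set` `[- B, B]].
  by apply: (@filterE _ F) => x; rewrite /= in_itv/= -ler_norml.
have [l [_ gFl]] := @segment_compact R (- B) B (g @ F) _ gBF.
apply/cvg_ex; exists l => U Ul.
have [//|FnU] := in_ultra_setVsetC (g @^-1` U) FU.
by have [y []] := gFl (~` U) U FnU Ul.
Qed.

Lemma cvg_initial (S : choiceType) (T : topologicalType) (h : S -> T)
    (F : set_system S) (s : S) : Filter F ->
  h @ F --> h s -> F --> (s : initial_topology h).
Proof.
move=> FF hF A [_ [[B oB <-] Bs BA]].
by apply: filterS BA _; apply: hF; exact: open_nbhs_nbhs.
Qed.

Section weak_star_topology.
Context {R : realType} {M : ptopologicalType}.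
Implicit Types (mu nu : borel_prob R M) (phi : continuousType M R).

(** The topology is initial in two stages: for [pairing], and then for the
    evaluations of the product topology. *)
Lemma cvg_borel_prob (F : set_system (borel_prob R M)) mu : Filter F ->
  (forall phi, (fun nu : borel_prob R M => (\int[nu]_x (phi x : R))%R) @ F -->
    (\int[mu]_x (phi x : R))%R) ->
  F --> mu.
Proof.
move=> FF h; apply: cvg_initial; apply/cvg_sup => phi.
exact: (@cvg_initial (continuousType M R -> R) R (fun g => g phi)
  (@pairing R M @ F) (@pairing R M mu) _ (h phi)).
Qed.

Lemma Rintegral_borel_prob_of (mu : probability (borel M) R) (f : M -> R) :
  (\int[borel_prob_of mu]_x (f x : R) = \int[mu]_x (f x : R))%R.
Proof.
congr fine; apply: eq_measure_integral => A mA _.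
by rewrite /= /off_borel0 asboolT.
Qed.

End weak_star_topology.

Section compactness_of_measures.
Context {R : realType} {M : ptopologicalType}.
Hypotheses (cM : compact [set: M]) (hM : hausdorff_space M).

(** Along an ultrafilter every bounded real function converges, so the integrals of
    each continuous function have a limit.  These limits form a normalized positive
    functional, and the measure representing it is a limit of the ultrafilter. *)
Theorem compact_borel_prob : compact [set: borel_prob R M].
Proof.
rewrite compact_ultra => F FU _.
pose I (mu : borel_prob R M) (f : M -> R) : R := (\int[mu]_x (f x))%R.
have HI mu : normalized_positive (I mu) by exact: Rintegral_np.
pose L f := lim (I mu f @[mu --> F]).
have IL f : continuous f -> I mu f @[mu --> F] --> L f.
  move=> cf; have [B _ fB] := continuous_bounded cM cf.
  apply: (@ultra_bounded_cvg _ _ F (I^~ f) B) => // mu.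
  have cB (c : R) : continuous (fun _ : M => c) by move=> x; exact: cvg_cst.
  rewrite ler_norml -[X in X <= _](np_cst (HI mu)) -[X in _ && (_ <= X)](np_cst (HI mu)).
  by apply/andP; split; apply: (le_np (HI mu)) => // x; have := fB x;
    rewrite ler_norml => /andP[].
have LE f l : I mu f @[mu --> F] --> l -> L f = l by move=> /cvg_lim; apply.
have HL : normalized_positive L.
  split=> [f g cf cg|c f cf|f cf f0|].
  - apply: LE; under eq_fun do rewrite npD//.
    by apply: cvgD; exact: IL.
  - apply: LE; under eq_fun do rewrite npZ//.
    by apply: cvgM; [exact: cvg_cst|exact: IL].
  - apply: limr_ge; first by apply/cvg_ex; exists (L f); exact: IL.
    by apply: nearW => mu; exact: np_ge0.
  - by apply: LE; under eq_fun do rewrite np1//; exact: cvg_cst.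
have [mu muL] := riesz_representation cM hM HL.
exists (borel_prob_of mu); split=> //; apply: cvg_borel_prob => phi.
have cphi : continuous (phi : M -> R) by exact: cts_fun.
rewrite Rintegral_borel_prob_of muL//; exact: (IL phi).
Qed.

End compactness_of_measures.

(** * Continuity of the empirical measures *)

Section empirical_measures.
Context {R : realType} {M : ptopologicalType}.
Hypothesis cM : compact [set: M].
Variable f : M -> M.
Hypothesis cf : continuous f.

Lemma continuous_iter n : continuous (iter n f).
Proof.
elim: n => [x|n ih x]; first exact: cvg_id.
by apply: continuous_comp; [exact: ih|exact: cf].
Qed.

(** Integrals against sums and multiples of measures are computed for nonnegative
    functions; adding a constant reduces the general case to that one. *)
Lemma Rintegral_empirical x n (phi : M -> R) : continuous phi ->
  (\int[empirical R f x n]_y (phi y))%R =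
  n.+1%:R^-1 * \sum_(j < n.+1) phi (iter j f x).
Proof.
have pos (g : M -> R) : continuous g -> (forall y, 0 <= g y) ->
    (\int[empirical R f x n]_y (g y))%R =
    n.+1%:R^-1 * \sum_(j < n.+1) g (iter j f x).
  move=> cg g0; rewrite Rintegral_borel_prob_of /Rintegral.
  have /measurable_EFinP mg := continuous_borel_measurable cg.
  rewrite ge0_integral_mscale//=; last by move=> y _; rewrite lee_fin.
  rewrite ge0_integral_measure_sum//; last by move=> y _; rewrite lee_fin.
  rewrite (eq_bigr (fun j : 'I_n.+1 => (g (iter j f x))%:E)).
    by rewrite sumEFin -EFinM.
  by move=> j _; rewrite integral_dirac// diracT mul1e.
move=> cphi; have [B B0 phiB] := continuous_bounded cM cphi.
have cB (c : R) : continuous (fun _ : M => c) by move=> y; exact: cvg_cst.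
have := pos (fun y => phi y + B) _ _.
rewrite (npD (Rintegral_np cM _))// (np_cst (Rintegral_np cM _)).
rewrite big_split/= sumr_const card_ord mulrDr -[B *+ _]mulr_natl mulKf ?pnatr_eq0//.
move=> /(_ _ _)/addIr; apply => y; last by have := phiB y; rewrite ler_norml => /andP[]; lra.
by apply: cvgD; [exact: cphi|exact: cB].
Qed.

Lemma continuous_empirical n : continuous (fun x => empirical R f x n).
Proof.
move=> x; apply: cvg_borel_prob => phi.
have cphi : continuous (phi : M -> R) by exact: cts_fun.
have intE y := Rintegral_empirical y n cphi.
rewrite intE -[X in X --> _]/((fun y => (\int[empirical R f y n]_z (phi z : R))%R) @ x).
under eq_fun do rewrite intE.
apply: cvgM; first exact: cvg_cst.
apply: (@cvg_big _ _ +%R) => [|j _]; first exact: add_continuous.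
apply: continuous_comp; first exact: continuous_iter.
exact: cphi.
Qed.

End empirical_measures.

(** * Topologies induced by a metric *)

Section metrized_spaces.
Context {R : realType} {T : topologicalType}.
Variable dist : T -> T -> R.
Hypothesis Hd : metrizes dist.
Implicit Types (x y z : T) (A U : set T) (e r : R).

Lemma metrizes_ge0 x y : 0 <= dist x y.
Proof.
have := dist_triangle Hd y x x.
by rewrite (dist_xx Hd) (dist_sym Hd y x); lra.
Qed.

Lemma nbhs_dist x e : 0 < e -> nbhs x [set y | dist x y < e].
Proof. by move=> e0; apply/(dist_nbhs Hd); exists e. Qed.

Lemma open_dist x e : open [set y | dist x y < e].
Proof.
rewrite openE => y /= xye; apply/(dist_nbhs Hd).
exists (e - dist x y); first by rewrite subr_gt0.
by move=> z /= yz; have := dist_triangle Hd y x z; lra.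
Qed.

Lemma closed_dist x r : closed [set y | dist x y <= r].
Proof.
rewrite -openC openE => y /= /negP; rewrite -ltNge => rxy.
apply/(dist_nbhs Hd); exists (dist x y - r); first by rewrite subr_gt0.
move=> z /= yz; apply/negP; rewrite -ltNge.
by have := dist_triangle Hd z x y; rewrite (dist_sym Hd z y); lra.
Qed.

Lemma open_distP U x : open U -> U x ->
  exists2 e, 0 < e & [set y | dist x y < e] `<=` U.
Proof. by move=> oU Ux; apply/(dist_nbhs Hd); exact: open_nbhs_nbhs. Qed.

Lemma metrizes_hausdorff : hausdorff_space T.
Proof.
move=> x y xy; apply: (dist_separated Hd); apply: contrapT => /eqP xyN0.
have xy0 : 0 < dist x y by rewrite lt0r xyN0 metrizes_ge0.
have e0 : 0 < dist x y / 2 by rewrite divr_gt0.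
have [z [/= xz yz]] := xy _ _ (nbhs_dist x e0) (nbhs_dist y e0).
by have := dist_triangle Hd z x y; rewrite (dist_sym Hd z y); lra.
Qed.

Lemma cvg_distP (u : nat -> T) x : u @ \oo --> x <->
  forall e, 0 < e -> \forall n \near \oo, dist x (u n) < e.
Proof.
split=> [ux e e0|h A /(dist_nbhs Hd)[e e0 eA]].
  exact: (ux _ (nbhs_dist x e0)).
by apply: filterS (h e e0) => n; exact: eA.
Qed.

Lemma cluster_subseq (u : nat -> T) x :
  (forall e N, 0 < e -> exists2 n, (N <= n)%N & dist x (u n) < e) ->
  exists2 s : nat -> nat, increasing_seq s & u (s k) @[k --> \oo] --> x.
Proof.
move=> h.
have /choice[g Hg] (kN : nat * nat) : exists n,
    (kN.2 <= n)%N /\ dist x (u n) < kN.1.+1%:R^-1.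
  have k0 : 0 < kN.1.+1%:R^-1 :> R by rewrite invr_gt0 ltr0n.
  by have [n Nn un] := h kN.1.+1%:R^-1 kN.2 k0; exists n.
(* the time found at step k + 1 is later than s k and 1 / (k + 2)-close to x *)
pose s := fix s k := if k is k'.+1 then g (k, (s k').+1) else g (0, 0)%N.
have us k : dist x (u (s k)) < k.+1%:R^-1.
  by case: k => [|k]; [exact: (Hg (0, 0)%N).2|exact: (Hg (k.+1, (s k).+1)).2].
exists s; first by apply/increasing_seqP => k; exact: (Hg (k.+1, (s k).+1)).1.
apply/cvg_distP => e e0; have [n ne] := ltr_add_invr e0.
exists n => // k /= nk; apply: lt_trans (us k) _.
by rewrite add0r in ne; apply: le_lt_trans ne; rewrite lef_pV2 ?posrE// ler_nat.
Qed.

(** Sequential compactness along the times at which the sequence visits [A]. *)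
Lemma frequently_compact_subseq (u : nat -> T) A : compact A ->
  (forall N, exists2 n, (N <= n)%N & A (u n)) ->
  exists2 x, A x &
    exists2 s : nat -> nat, increasing_seq s & u (s k) @[k --> \oo] --> x.
Proof.
move=> cA uA.
pose F := filter_from setT (fun N => [set u n | n in [set n | (N <= n)%N /\ A (u n)]]).
have FF : ProperFilter F.
  apply: filter_from_proper; last first.
    by move=> N _; have [n Nn An] := uA N; exists (u n), n.
  apply: filter_from_filter; first by exists 0%N.
  move=> i j _ _; exists (maxn i j) => //.
  move=> _ [n [+ An] <-]; rewrite geq_max => /andP[ni nj].
  by split; exists n.
have FA : F A by exists 0%N => // _ [n [_ An] <-].
have [x [Ax clx]] := cA F FF FA; exists x => //.
apply: cluster_subseq => e N e0.
have FN : F [set u n | n in [set n | (N <= n)%N /\ A (u n)]] by exists N.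
by have [_ [[n [Nn _] <-] /= xe]] := clx _ _ FN (nbhs_dist x e0); exists n.
Qed.

End metrized_spaces.

Section lindelof.
Context {R : realType} {T : ptopologicalType}.
Variable dist : T -> T -> R.
Hypotheses (Hd : metrizes dist) (cT : compact [set: T]).

(** A Lindelof property with radii prescribed by [r]: the open set [U] is the union
    of the compact sets [K k] of points at distance at least [1 / (k + 1)] from its
    complement, and finitely many balls cover each of them. *)
Lemma open_countable_cover (U : set T) (r : T -> R) : open U -> U !=set0 ->
  (forall x, U x -> 0 < r x) ->
  exists2 c : nat -> T, (forall i, U (c i)) &
    U `<=` \bigcup_i [set y | dist (c i) y < r (c i)].
Proof.
move=> oU U0 r0.
pose K k := [set y | forall z, ~ U z -> k.+1%:R^-1 <= dist y z].
have KU k : K k `<=` U.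
  move=> y Ky; apply: contrapT => /Ky; rewrite (dist_xx Hd) leNgt.
  by rewrite invr_gt0 ltr0n.
have cK k : compact (K k).
  apply: subclosed_compact cT _ => //.
  rewrite -openC openE => y /= /existsNP[z /not_implyP[Uz /negP]].
  rewrite -ltNge => yz; apply/(dist_nbhs Hd).
  exists (k.+1%:R^-1 - dist y z); first by rewrite subr_gt0.
  move=> w /= yw /(_ z Uz); apply/negP; rewrite -ltNge.
  have := dist_triangle Hd y w z; rewrite (dist_sym Hd w y).
  by move: (k.+1%:R^-1) yw => d yw; lra.
have /choice[D HD] k : exists D : {fset T}, [set` D] `<=` U /\
    K k `<=` \bigcup_(x in [set` D]) [set y | dist x y < r x].
  have := cK k; rewrite compact_cover.
  move=> /(_ T (K k) (fun x => [set y | dist x y < r x])) [].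
  - by move=> x _; exact: open_dist.
  - by move=> x Kx; exists x => //=; rewrite (dist_xx Hd) r0//; exact: KU Kx.
  - move=> D DK KD; exists D; split=> // x /= /DK/set_mem; exact: KU.
pose C := \bigcup_k [set` D k].
have UC : U `<=` \bigcup_(x in C) [set y | dist x y < r x].
  move=> y Uy; have [e e0 eU] := open_distP Hd oU Uy.
  have [k] := ltr_add_invr e0; rewrite add0r => ke.
  have /(HD k).2[x Dx xy] : K k y.
    move=> z Uz; rewrite leNgt; apply/negP => yz; apply: Uz.
    by apply: eU => /=; exact: lt_trans ke.
  by exists x => //; exists k.
have : countable C.
  by apply: bigcup_countable => // k _; exact/finite_set_countable/finite_fset.
move=> /pfcard_geP[C0|[c]].
  by have [y /UC[x]] := U0; rewrite C0.
exists c => [i|y /UC[x Cx xy]].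
  have /(_ i I)[k _ /= Dk] := @funS _ _ _ _ c.
  exact: (HD k).1 Dk.
by have [i _ ci] := @surj _ _ _ _ c x Cx; exists i => //=; rewrite ci.
Qed.

End lindelof.

(** * Limit measures and their basins *)

(** The default measure is the Dirac mass at the base point of [M]. *)
HB.instance Definition _ (R : realType) (M : ptopologicalType) :=
  isPointed.Build (borel_prob R M) (empirical R id point 0).

Section limit_measures.
Context {R : realType} {M : ptopologicalType}.
Hypotheses (cM : compact [set: M]) (hM : hausdorff_space M).
Variables (f : M -> M) (dist : borel_prob R M -> borel_prob R M -> R).
Hypotheses (cf : continuous f) (Hd : metrizes dist).
Implicit Types (mu nu : borel_prob R M) (K : set (borel_prob R M)).

(** The set whose measure decides whether [mu] is observable. *)
Definition pomega_near mu (e : R) : set M :=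
  [set x | (dist_to dist (pomega f x) mu < e%:E)%E].

Lemma pomega_nearP mu e x :
  pomega_near mu e x <-> exists2 nu, pomega f x nu & dist mu nu < e.
Proof.
split=> [/ereal_inf_lt[_ [nu fnu <-]]|[nu fnu nue]].
  by rewrite lte_fin (dist_sym Hd) => nue; exists nu.
apply: (@le_lt_trans _ _ (dist nu mu)%:E); last by rewrite lte_fin (dist_sym Hd).
by apply: ereal_inf_lbound; exists nu.
Qed.

(** By compactness, a ball around [mu] contains a limit measure of [x] as soon as a
    smaller one is visited infinitely often by the empirical measures of [x]; the
    slack [1 / (k + 1)] absorbs the passage from open to closed balls. *)
Lemma pomega_nearE mu e : pomega_near mu e =
  \bigcup_k \bigcap_N \bigcup_(n in [set n | (N <= n)%N])
    [set x | dist mu (empirical R f x n) < e - k.+1%:R^-1].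
Proof.
apply/seteqP; split=> x.
  move=> /pomega_nearP[nu [s s_inc snu] mue].
  have [k ke] := ltr_add_invr mue; exists k => // N _.
  move: k.+1%:R^-1 ke => d ke; have e0 : 0 < e - d - dist mu nu by lra.
  have [n0 _ hn] := (cvg_distP Hd _ _).1 snu _ e0.
  have s_ge n : (n <= s n)%N.
    elim: n => // n ih; apply: leq_ltn_trans ih _.
    exact: (increasing_seqP s).2 s_inc n.
  exists (s (maxn n0 N)) => /=.
    by apply: leq_trans (s_ge _); exact: leq_maxr.
  have /= := hn _ (leq_maxl n0 N).
  by have := dist_triangle Hd nu mu (empirical R f x (s (maxn n0 N))); lra.
move=> [k _ hk]; apply/pomega_nearP.
have cA : compact [set nu | dist mu nu <= e - k.+1%:R^-1].
  by apply: subclosed_compact (compact_borel_prob cM hM) _ => //; exact: closed_dist.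
have [|nu /= nue [s s_inc snu]] := frequently_compact_subseq Hd
    (u := fun n => empirical R f x n) cA.
  by move=> N; have [n /= Nn /ltW] := hk N I; exists n.
exists nu; first by exists s.
by apply: le_lt_trans nue _; rewrite ltrBlDr ltrDl invr_gt0 ltr0n.
Qed.

Lemma borel_pomega_near mu e : borel_set (pomega_near mu e).
Proof.
rewrite pomega_nearE; apply: bigcupT_measurable => k.
apply: bigcapT_measurable => N; apply: bigcup_measurable => n _.
apply: borel_set_open.
have := open_dist Hd mu (e - k.+1%:R^-1).
by apply: open_comp => x _; exact: continuous_empirical.
Qed.

Lemma sub_pomega_near mu nu e e' : dist mu nu + e <= e' ->
  pomega_near nu e `<=` pomega_near mu e'.
Proof.
move=> ee' x /pomega_nearP[p fp pe]; apply/pomega_nearP; exists p => //.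
by have := dist_triangle Hd nu mu p; lra.
Qed.

(** A point belongs to the basin of [K] when its limit measures avoid every ball of
    a family that covers the complement of [K]. *)
Lemma basinE K (r : borel_prob R M -> R) (c : nat -> borel_prob R M) :
  (forall i, [set nu | dist (c i) nu < r (c i)] `<=` ~` K) ->
  ~` K `<=` \bigcup_i [set nu | dist (c i) nu < r (c i)] ->
  basin f K = ~` \bigcup_i pomega_near (c i) (r (c i)).
Proof.
move=> cK Kc; apply/seteqP; split=> x.
  move=> fK [i _ /pomega_nearP[nu fnu nur]].
  by apply: (cK i nu nur); exact: fK.
move=> xN nu fnu; apply: contrapT => /Kc[i _ /= nur].
by apply: xN; exists i => //; apply/pomega_nearP; exists nu.
Qed.

Lemma basinT : basin f [set: borel_prob R M] = setT.
Proof. by apply/seteqP; split. Qed.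

(** The radius of the balls is free, which serves twice: small radii make the basin
    a Borel set, and radii of negligible [pomega_near] show that the basin of the
    observable measures has full measure.  When [K] is the whole space there is no
    centre to choose, whence the disjunction. *)
Lemma closed_basinE K (r : borel_prob R M -> R) : closed K ->
  (forall mu, ~ K mu -> 0 < r mu /\ [set nu | dist mu nu < r mu] `<=` ~` K) ->
  basin f K = setT \/
    exists2 c : nat -> borel_prob R M, (forall i, ~ K (c i)) &
    basin f K = ~` \bigcup_i pomega_near (c i) (r (c i)).
Proof.
move=> clK rK; have [K0|/set0P/negP/negPn/eqP K0] := pselect ((~` K) !=set0); last first.
  by left; rewrite -(setCK K) K0 setC0 basinT.
right; have [||c cK Kc] := open_countable_cover Hd (compact_borel_prob cM hM)
    (U := ~` K) (r := r) _ K0; [exact: closed_openC|by move=> mu /rK[]|].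
by exists c => //; apply: basinE => // i; have [] := rK _ (cK i).
Qed.

Lemma borel_basin K : closed K -> borel_set (basin f K).
Proof.
move=> clK.
have /choice[r rK] mu : exists e, ~ K mu -> 0 < e /\ [set nu | dist mu nu < e] `<=` ~` K.
  have [Kmu|nKmu] := pselect (K mu); first by exists 0.
  by have [e e0 eK] := open_distP Hd (closed_openC clK) nKmu; exists e.
have [->|[c _ ->]] := closed_basinE clK rK; first exact: measurableT.
by apply: measurableC; apply: bigcupT_measurable => i; exact: borel_pomega_near.
Qed.

Section observability.
Variable m : probability (borel M) R.

Lemma le_pomega_near mu nu e e' : dist mu nu + e <= e' ->
  (m (pomega_near nu e) <= m (pomega_near mu e'))%E.
Proof.
move=> ee'; apply: le_measure; [apply/mem_set|apply/mem_set|].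
- exact: borel_pomega_near.
- exact: borel_pomega_near.
- exact: sub_pomega_near.
Qed.

Lemma closed_observable : closed (observable m f dist).
Proof.
move=> mu clmu e e0; have e20 : 0 < e / 2 by rewrite divr_gt0.
have [nu [/(_ _ e20) Onu /= munu]] := clmu _ (nbhs_dist Hd mu e20).
by apply: lt_le_trans Onu (le_pomega_near _); lra.
Qed.

Lemma compact_observable : compact (observable m f dist).
Proof.
exact: subclosed_compact closed_observable (compact_borel_prob cM hM) _.
Qed.

(** A measure that is not observable is the centre of a ball that almost no point
    approaches.  That ball contains no observable measure, and countably many such
    balls cover the complement of the observable measures. *)
Lemma basin_observable : m (basin f (observable m f dist)) = 1%E.
Proof.
have /choice[r rO] mu : exists e, ~ observable m f dist mu ->
    0 < e /\ m (pomega_near mu e) = 0%E.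
  have [Omu|/existsNP[e /not_implyP[e0 /negP]]] := pselect (observable m f dist mu).
    by exists 0.
  rewrite -leNgt => me; exists e => _; split=> //.
  by apply/eqP; rewrite eq_le me measure_ge0.
have rO' mu : ~ observable m f dist mu ->
    0 < r mu /\ [set nu | dist mu nu < r mu] `<=` ~` observable m f dist.
  move=> /rO[r0 mr]; split=> // nu /= nur Onu.
  (* an observable nu in the ball would see positive measure from its own, smaller ball *)
  have e0 : 0 < r mu - dist mu nu by rewrite subr_gt0.
  have := Onu _ e0; rewrite ltNge -[X in (_ <= X)%E]mr => /negP; apply.
  by apply: le_pomega_near; lra.
have [->|[c cO ->]] := closed_basinE closed_observable rO'.
  exact: probability_setT.
have mA i : measurable (pomega_near (c i) (r (c i)) : set (borel M)).
  exact: borel_pomega_near.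
rewrite probability_setC; last exact: bigcupT_measurable.
rewrite (_ : m _ = 0%E) ?sube0//; apply: measure_negligible.
  exact: bigcupT_measurable.
by apply: negligible_bigcup => i; apply/negligibleP => //; have [] := rO _ (cO i).
Qed.

(** A ball around [mu] that avoids [K] is approached by a set of points of positive
    measure, and this set is disjoint from the basin of [K]. *)
Lemma observable_minimal K : closed K -> m (basin f K) = 1%E ->
  observable m f dist `<=` K.
Proof.
move=> clK mK mu Omu; apply: contrapT => nKmu.
have [e e0 eK] := open_distP Hd (closed_openC clK) nKmu.
have mA : measurable (pomega_near mu e : set (borel M)) by exact: borel_pomega_near.
have : (m (basin f K) <= m (~` pomega_near mu e))%E.
  apply: le_measure; [apply/mem_set|apply/mem_set|].
  - exact: borel_basin.
  - exact: measurableC.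
  - by move=> x fK /pomega_nearP[nu /fK Knu /eK].
rewrite mK probability_setC//; have := Omu e e0.
have := fin_num_measure m _ mA.
case: (m _) => // a _; rewrite lte_fin -EFinB lee_fin => a0.
by rewrite leNgt ltrBlDr ltrDl a0.
Qed.

End observability.
End limit_measures.

Theorem theorem1p5 (R : realType) (M : ptopologicalType) (n : nat)
    (atlas : set (chart R M n))
    (hcompact : compact [set: M]) (hhausdorff : hausdorff_space M)
    (hatlas : C1_atlas atlas)
    (m : probability (borel M) R) (hm : lebesgue_on_manifold atlas m)
    (f : M -> M) (hf : continuous f)
    (dist : borel_prob R M -> borel_prob R M -> R) (hdist : metrizes dist) :
  [/\ compact (observable m f dist),
      m (basin f (observable m f dist)) = 1%E &
      forall K : set (borel_prob R M),
        K !=set0 -> compact K -> m (basin f K) = 1%E ->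
        observable m f dist `<=` K].
Proof.
split; [exact: compact_observable|exact: basin_observable|].
move=> K _ cK; apply: observable_minimal => //.
exact: compact_closed (metrizes_hausdorff hdist) cK.
Qed.
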